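(* Let $G$ be a finite group and suppose that $m$ is the maximal order of an abelian subgroup of $G$. Suppose that $|G|$ is divisible by a prime $p > m/2$. Then one of the following holds: (1) $G = PC$ where $|P| = p$ and $C$ acts faithfully on $P$ (and so $C$ is non-trivial cyclic of order dividing $p-1$); (2) $G \cong S_3$ with $p = 2$ or $3$; (3) $G$ contains $\mathbf{F}(\mathrm{A\Gamma L}_1(2^a))$, where $p = 2^a - 1$ is a Mersenne prime; or (4) $G$ is almost simple.
   Context: In (1), $P$ and $C$ are subgroups of $G$ and $C$ acts on $P$ by conjugation. $S_3$ is the symmetric group of degree $3$. $\mathbf{F}(H)$ denotes the Fitting subgroup of a finite group $H$ (its largest nilpotent normal subgroup). $\mathrm{A\Gamma L}_1(q)$ is the group of affine semilinear permutations $x \mapsto b\,x^{\sigma} + c$ of the finite field $\mathbb{F}_q$, with $b \in \mathbb{F}_q^{\times}$, $c \in \mathbb{F}_q$, $\sigma \in \mathrm{Aut}(\mathbb{F}_q)$; in (3), containment is up to isomorphism. A finite group $G$ is almost simple if there is a non-abelian finite simple group $S$ with $S \leq G \leq \mathrm{Aut}(S)$ up to isomorphism (where $S$ is identified with its group of inner automorphisms); non-abelian simple groups themselves are included.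
   Formalization: In (1), ''C is non-trivial'' is asserted only when |G| is not p: for G cyclic of order p the hypotheses hold, but C must be trivial and none of (2)–(4) holds. *)

(* Defs.v *)
From HB Require Import structures.
From mathcomp Require Import all_boot all_order all_algebra all_fingroup.
From mathcomp Require Import all_solvable all_field.

Set Implicit Arguments.
Unset Strict Implicit.
Unset Printing Implicit Defensive.

Import GroupScope GRing.Theory.

Section AffineSemilinear.

Variable F : finFieldType.

Definition field_auts : {set {perm F}} :=
  [set s : {perm F} | [&& s 1%R == 1%R,
     [forall x, forall y, s (x + y)%R == (s x + s y)%R] &
     [forall x, forall y, s (x * y)%R == (s x * s y)%R]]].

Definition AGammaL1 : {set {perm F}} :=
  [set f : {perm F} | [exists b : F, exists c : F, exists s in field_auts,
     (b != 0%R) && [forall x, f x == (b * s x + c)%R]]].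

Lemma field_autsP (s : {perm F}) :
  reflect [/\ s 1%R = 1%R, {morph s : x y / (x + y)%R} &
              {morph s : x y / (x * y)%R}]
          (s \in field_auts).
Proof.
rewrite inE; apply: (iffP and3P) => [[/eqP s1 /forallP sD /forallP sM] | [s1 sD sM]].
  by split=> // x y; apply/eqP; [apply: (forallP (sD x)) | apply: (forallP (sM x))].
by split; [apply/eqP | apply/forallP=> x; apply/forallP=> y; apply/eqP..].
Qed.

Lemma AGammaL1P (f : {perm F}) :
  reflect (exists b c : F, exists2 s, s \in field_auts &
             b != 0%R /\ forall x, f x = (b * s x + c)%R)
          (f \in AGammaL1).
Proof.
rewrite inE; apply: (iffP existsP) => [[b /existsP[c /exists_inP[s sA]]] | [b [c [s sA [nzb fE]]]]].
  by case/andP=> nzb /forallP fE; exists b, c, s => //; split=> // x; apply/eqP.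
exists b; apply/existsP; exists c; apply/exists_inP; exists s => //.
by rewrite nzb; apply/forallP=> x; rewrite fE.
Qed.

Lemma group_set_field_auts : group_set field_auts.
Proof.
apply/group_setP; split=> [|s t].
  by apply/field_autsP; split=> [|x y|x y]; rewrite !perm1.
move=> /field_autsP[s1 sD sM] /field_autsP[t1 tD tM].
by apply/field_autsP; split=> [|x y|x y]; rewrite !permM ?s1 ?t1 ?sD ?tD ?sM ?tM.
Qed.
Canonical field_auts_group := group group_set_field_auts.

Lemma group_set_AGammaL1 : group_set AGammaL1.
Proof.
apply/group_setP; split=> [|f g].
  apply/AGammaL1P; exists 1%R, 0%R, 1; first exact: group1.
  by split=> [|x]; rewrite ?oner_neq0 // !perm1 mul1r addr0.
move=> /AGammaL1P[b [c [s sA [nzb fE]]]] /AGammaL1P[d [e [t tA [nzd gE]]]].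
have /field_autsP[_ tD tM] := tA.
have t0 : t 0%R = 0%R by apply: (addrI (t 0%R)); rewrite -tD !addr0.
apply/AGammaL1P; exists (d * t b)%R, (d * t c + e)%R, (s * t); first exact: groupM.
split=> [|x]; last by rewrite !permM gE fE tD tM mulrDr mulrA addrA.
by rewrite mulf_neq0 // -t0 (inj_eq perm_inj).
Qed.
Canonical AGammaL1_group := group group_set_AGammaL1.

End AffineSemilinear.

(* [conj_aut S @* S] is the group of inner automorphisms of [S]. *)
Definition almost_simple (gT : finGroupType) (G : {group gT}) : Prop :=
  exists (sT : finGroupType) (S : {group sT}) (H : {group {perm sT}}),
    [/\ simple S, ~~ abelian S, conj_aut S @* S \subset H, H \subset Aut S
      & G \isog H].

(* Main.v *)
Require Import Defs.
From HB Require Import structures.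
From mathcomp Require Import all_boot all_order all_algebra all_fingroup.
From mathcomp Require Import all_solvable all_field.

Set Implicit Arguments.
Unset Strict Implicit.
Unset Printing Implicit Defensive.

Import GroupScope GRing.Theory.

(** Let [P] have order [p].  An abelian subgroup of [G] containing [P] has order
    a multiple of [p] below [2p], hence equals [P]; so [P] is its own
    centralizer in [G], and therefore a full Sylow [p]-subgroup.  Let [N] be a
    minimal normal subgroup of [G].

    If [p] divides [#|N|], then [N] is a direct product of isomorphic simple
    groups whose order [p] divides only once, so [N] is simple.  When [N] is
    abelian it is a normal Sylow [p]-subgroup, and a complement acts faithfully
    on it: conclusion (1).  Otherwise the centralizer of [N] lies in the
    self-centralizing subgroup [P], which is contained in [N]; so it is central
    in [N], hence trivial, and [G] embeds in [Aut N]: conclusion (4).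

    If [p] does not divide [#|N|], then [P] acts on [N] without nontrivial fixed
    points, so the order of every [P]-invariant subgroup of [N] is 1 modulo [p],
    and that of a nontrivial abelian one is exactly [p + 1].  For each prime [r]
    dividing [#|N|] this applies to the centre of a [P]-invariant Sylow
    [r]-subgroup of [N], so [p + 1] is a power of [r].  Hence [r] is 3 if [p] is
    2, and is 2 if [p] is odd ([normal_p'group_prime_divisors]); so [N] is a
    [q]-group for a single prime [q], thus elementary abelian of order [p + 1].
    When [p = 2], [N] is self-centralizing of order 3, so
    [#|G|] is 6 and [G] contains two distinct involutions: conclusion (2).  When
    [p] is odd, [p + 1 = 2 ^ a], and [N] is isomorphic to the translation group
    of the field of order [2 ^ a], which is the Fitting subgroup of its affine
    semilinear group ([Fitting_AGammaL1]): conclusion (3). *)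

(** * The Fitting subgroup of the affine semilinear group *)

Section FittingAffine.

Variable F : finFieldType.

Definition translation (c : F) : {perm F} := perm (@addIr F c).

Definition translations : {set {perm F}} := [set translation c | c : F].

Lemma translationE c x : translation c x = (x + c)%R.
Proof. by rewrite permE. Qed.

Lemma translationM b c :
  translation b * translation c = translation (b + c)%R.
Proof. by apply/permP=> x; rewrite permM !translationE addrA. Qed.

Lemma translation0 : translation 0%R = 1.
Proof. by apply/permP=> x; rewrite translationE perm1 addr0. Qed.

Lemma translation_inj : injective translation.
Proof. by move=> b c /permP/(_ 0%R); rewrite !translationE !add0r. Qed.

Lemma group_set_translations : group_set translations.
Proof.
apply/group_setP; split=> [|_ _ /imsetP[b _ ->] /imsetP[c _ ->]].
  by rewrite -translation0 imset_f.
by rewrite translationM imset_f.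
Qed.
Canonical translations_group := group group_set_translations.

Lemma card_translations : #|translations| = #|F|.
Proof. by rewrite card_imset //; apply: translation_inj. Qed.

Lemma translations_abelem q : q \in [pchar F]%R -> q.-abelem translations.
Proof.
move=> chq; apply/abelemP; first exact: pcharf_prime chq.
split=> [|_ /imsetP[c _ ->]].
  apply/centsP=> _ /imsetP[b _ ->] _ /imsetP[c _ ->].
  by rewrite /commute !translationM addrC.
have expE n : translation c ^+ n = translation (c *+ n)%R.
  by elim: n => [|n IHn]; rewrite ?translation0 // expgS IHn translationM mulrS.
by rewrite expE -mulr_natr (pcharf0 chq) mulr0 translation0.
Qed.

(** A permutation [f] commuting with all translations is determined by its value
    at 0, since [f x = f (0 + x) = f 0 + x]. *)
Lemma cent_translations : 'C(translations) \subset translations.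
Proof.
apply/subsetP=> f /centP cTf; apply/imsetP; exists (f 0%R) => //.
apply/permP=> x; rewrite translationE.
have /permP/(_ 0%R) := cTf _ (imset_f translation (isT : x \in predT)).
by rewrite !permM !translationE add0r addrC => <-.
Qed.

Lemma translations_normal : translations <| AGammaL1 F.
Proof.
apply/andP; split.
  apply/subsetP=> _ /imsetP[c _ ->]; apply/AGammaL1P.
  exists 1%R, c, 1; first exact: group1.
  by split=> [|x]; rewrite ?oner_neq0 // translationE perm1 mul1r.
apply/subsetP=> f /AGammaL1P[b [c [s /field_autsP[_ sD _] [_ fE]]]].
rewrite inE; apply/subsetP=> _ /imsetP[_ /imsetP[d _ ->] ->].
apply/imsetP; exists (b * s d)%R => //; apply/permP=> x.
rewrite conjgE !permM !translationE -{2}(permKV f x) !fE sD mulrDr.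
by rewrite -!addrA (addrC c).
Qed.

(** Conjugating by the multiplication by [c / b] sends translation by [b] to
    translation by [c]; so a normal subgroup containing one nontrivial
    translation contains them all. *)
Lemma translations_conj_transitive (b c : F) : b != 0%R -> c != 0%R ->
  exists2 f, f \in AGammaL1 F & translation b ^ f = translation c.
Proof.
move=> nzb nzc; have nzd : (c / b != 0)%R by rewrite mulf_neq0 ?invr_eq0.
exists (perm (mulfI nzd)).
  apply/AGammaL1P; exists (c / b)%R, 0%R, 1; first exact: group1.
  by split=> // x; rewrite permE perm1 addr0.
apply/permP=> x; rewrite conjgE !permM !translationE permE /=.
rewrite mulrDr divfK //; congr (_ + _)%R.
by rewrite -{2}(permKV (perm (mulfI nzd)) x) [RHS]permE.
Qed.

(** A nontrivial normal subgroup of a nilpotent group meets the centre, so the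
    centre of the Fitting subgroup contains a nontrivial translation, hence all
    of them.  The Fitting subgroup thus centralizes the translations, which are
    self-centralizing. *)
Lemma Fitting_AGammaL1 : 'F(AGammaL1 F) = translations.
Proof.
have [q q_pr chq] := finPcharP F.
have abT := abelem_abelian (translations_abelem chq).
have sTF : translations \subset 'F(AGammaL1 F).
  exact: Fitting_max translations_normal (abelian_nil abT).
apply/eqP; rewrite eqEsubset sTF andbT.
apply: subset_trans cent_translations; rewrite centsC.
have ntT : translations != 1.
  by rewrite -cardG_gt1 card_translations finNzRing_gt1.
have nTF : translations <| 'F(AGammaL1 F).
  by apply: normalS sTF (Fitting_sub _) translations_normal.
have [f] := trivgPn _ (meet_center_nil (Fitting_nil _) nTF ntT).
case/setIP=> /imsetP[b _ ->] Zb ntb.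
have nzb : b != 0%R by apply: contraNneq ntb => ->; rewrite translation0.
have nZ : 'Z('F(AGammaL1 F)) <| AGammaL1 F.
  exact: gFnormal_trans (Fitting_normal _).
have sTZ : translations \subset 'Z('F(AGammaL1 F)).
  apply/subsetP=> _ /imsetP[c _ ->].
  have [->|nzc] := eqVneq c 0%R; first by rewrite translation0 group1.
  have [g Ag <-] := translations_conj_transitive nzb nzc.
  by rewrite memJ_norm // (subsetP (normal_norm nZ)).
by rewrite (subset_trans sTZ) ?subsetIr.
Qed.

End FittingAffine.

(** * Groups of order six *)

(** Two distinct involutions generate a dihedral group; its order exceeds 2, is
    even and divides 6. *)
Lemma order6_dihedral (gT : finGroupType) (G : {group gT}) (x y : gT) :
    #|G| = 6 -> x \in G -> y \in G -> #[x] = 2 -> #[y] = 2 -> x != y ->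
  G \isog [set: 'D_6].
Proof.
move=> oG Gx Gy ox oy neq_xy.
set H := <<[set x; y]>>%G.
have sHG : H \subset G by rewrite gen_subG subUset !sub1set Gx.
have Hx : x \in H by rewrite mem_gen ?set21.
have Hy : y \in H by rewrite mem_gen ?set22.
have dvd2 : 2 %| #|H| by rewrite -ox order_dvdG.
have gt2 : 2 < #|H|.
  rewrite ltn_neqAle (dvdn_leq _ dvd2) // andbT eq_sym.
  apply: contraNneq neq_xy => oH.
  have eqH z : z \in H -> #[z] = 2 -> <[z]> = H.
    by move=> Hz oz; apply/eqP; rewrite eqEcard cycle_subG Hz oH -oz /=.
  have : x \in <[y]> by rewrite (eqH y).
  rewrite (cycle2g oy) !inE => /orP[/eqP x1 | //].
  by rewrite x1 order1 in ox.
have oH : #|H| = 6.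
  have := cardSg sHG; rewrite oG; move: dvd2 gt2.
  by move: #|H| => [|[|[|[|[|[|[|n]]]]]]] // _ _ /dvdn_leq; case: n.
have <- : H :=: G by apply/eqP; rewrite eqEcard sHG oG oH.
by rewrite -oH; apply: involutions_gen_dihedral.
Qed.

(** Both groups are dihedral of order 6: the symmetric group contains the distinct
    involutions [(0 1)] and [(0 2)]. *)
Lemma order6_Sym3 (gT : finGroupType) (G : {group gT}) (x y : gT) :
    #|G| = 6 -> x \in G -> y \in G -> #[x] = 2 -> #[y] = 2 -> x != y ->
  G \isog [set: 'S_3].
Proof.
move=> oG Gx Gy ox oy neq_xy.
apply: isog_trans (order6_dihedral oG Gx Gy ox oy neq_xy) _; rewrite isog_sym.
pose t i : 'S_3 := tperm ord0 (lift ord0 i).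
have ot i : #[t i] = 2.
  apply: nt_prime_order => //; first by rewrite expgS expg1 tperm2.
  by apply/eqP=> /permP/(_ ord0); rewrite tpermL perm1.
apply: (@order6_dihedral _ [set: 'S_3]%G (t ord0) (t ord_max)); rewrite ?inE //.
  by rewrite cardsT card_Sn.
by apply/eqP=> /permP/(_ ord0); rewrite !tpermL.
Qed.

(** * Two criteria on normal subgroups *)

(** A characteristically simple group is a direct power of a simple group [H], and
    with two or more factors [p ^ 2] would divide its order. *)
Lemma charsimple_simple (gT : finGroupType) (N : {group gT}) p :
    charsimple N -> prime p -> p %| #|N| -> ~~ (p ^ 2 %| #|N|) -> simple N.
Proof.
move=> chN p_pr pN p2N.
have [H [sHN simH [I _ defN]]] := charsimple_dprod chN.
have oimH f : f \in I -> #|f @: H| = #|H|.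
  by move=> _; rewrite card_imset //; apply: perm_inj.
have oN : (#|H| ^ #|I|)%N = #|N|.
  by rewrite -(bigdprod_card defN) (eq_bigr _ oimH) prod_nat_const.
have pH : p %| #|H| by move: pN; rewrite -oN Euclid_dvdX // => /andP[].
have leI1 : #|I| <= 1.
  rewrite leqNgt; apply: contra p2N => I2; rewrite -oN.
  by apply: dvdn_trans (dvdn_exp2l _ I2); rewrite dvdn_exp2r.
suffices <- : H :=: N by [].
apply/eqP; rewrite eqEcard sHN -oN -{2}(expn1 #|H|) leq_pexp2l //.
Qed.

(** Conjugation embeds [G] in [Aut N], since its kernel is the centralizer of [N],
    and it maps [N] onto the inner automorphisms. *)
Lemma almost_simple_cent1 (gT : finGroupType) (G N : {group gT}) :
  simple N -> ~~ abelian N -> N <| G -> 'C_G(N) = 1 -> almost_simple G.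
Proof.
move=> simN nabN /andP[sNG nNG] tiC.
exists gT, N, [group of conj_aut N @* G]; split=> //.
- exact: morphimS.
- exact: Aut_conj_aut.
apply: isog_trans (quotient1_isog G) _.
by have:= first_isog_loc (conj_aut N) nNG; rewrite /= ker_conj_aut tiC.
Qed.

(** * Self-centralizing subgroups of prime order *)

Section SelfCentralizing.

Variables (gT : finGroupType) (G P : {group gT}) (p : nat).
Hypotheses (p_pr : prime p) (oP : #|P| = p) (cGP : 'C_G(P) = P).

Let sPG : P \subset G.
Proof. by rewrite -cGP subsetIl. Qed.

(** The centre of a [p]-subgroup of [G] containing [P] centralizes [P], so it lies
    in [P] and, being nontrivial, equals [P]; the [p]-subgroup then centralizes
    [P], hence is [P]. *)
Lemma self_cent_Sylow : p.-Sylow(G) P.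
Proof.
have pP : p.-group P by rewrite /pgroup oP pnat_id.
have [S sylS sPS] := Sylow_superset sPG pP.
have pS := pHall_pgroup sylS; have sSG := pHall_sub sylS.
have ntP : P :!=: 1 by rewrite -cardG_gt1 oP prime_gt1.
have sZP : 'Z(S) \subset P.
  rewrite -cGP subsetI (subset_trans (center_sub S)) //=.
  by rewrite (subset_trans (subsetIr S 'C(S))) ?centS.
have ntZ : 'Z(S) != 1.
  rewrite (center_nil_eq1 (pgroup_nil pS)).
  by apply: contraNneq ntP => S1; rewrite -subG1 -S1.
have defP : 'Z(S) = P.
  apply/eqP; rewrite eqEcard sZP oP.
  rewrite trivg_card1 in ntZ.
  by have:= cardSg sZP; rewrite oP /= => /(prime_nt_dvdP p_pr ntZ) ->/=.
suffices -> : P :=: S by [].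
apply/eqP; rewrite eqEsubset sPS -cGP subsetI sSG /=.
by rewrite centsC -defP subsetIr.
Qed.

(** The points of [A] fixed by [P] form the intersection of [A] with [P], which is
    trivial; the other orbits have length [p]. *)
Lemma self_cent_p'card_mod (A : {group gT}) :
    A \subset G -> P \subset 'N(A) -> ~~ (p %| #|A|) -> #|A| = 1 %[mod p].
Proof.
move=> sAG nAP pA.
have pP : p.-group P by rewrite /pgroup oP pnat_id.
have fixAP : 'Fix_(A | 'J)(P) = 1.
  rewrite afixJ; apply/trivgP; rewrite -(coprime_TIg (_ : coprime #|A| #|P|)).
    by rewrite -{2}cGP setIA (setIidPl sAG).
  by rewrite oP coprime_sym prime_coprime.
have := pgroup_fix_mod (to := 'J%act) pP (_ : [acts P, on A | 'J]).
by rewrite fixAP cards1 astabsJ => ->.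
Qed.

(** A complement [C] meets the self-centralizing [P] trivially, so it acts
    faithfully on [P] and embeds in the cyclic group [Aut P] of order [p - 1]. *)
Lemma self_cent_normal_complement :
  P <| G ->
  exists C : {group gT},
    [/\ C \subset G, G = P * C :> {set gT},
        [acts C, on P | 'J] /\ [faithful C, on P | 'J]
      & [/\ cyclic C, #|C| %| p.-1 & (#|G| != p -> C :!=: 1)]].
Proof.
move=> nsPG; have nPG := normal_norm nsPG.
have /splitsP[C /complP[tiPC defG]] :=
  SchurZassenhaus_split (pHall_Hall self_cent_Sylow) nsPG.
have sCG : C \subset G by rewrite -defG mulG_subr.
have nPC : C \subset 'N(P) := subset_trans sCG nPG.
have cCP : 'C_C(P) = 1.
  by apply/trivgP; rewrite -tiPC subsetI subsetIl andbT
     (subset_trans (setSI _ sCG)) ?cGP.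
have isoC : C \isog conj_aut P @* C.
  apply: isog_trans (quotient1_isog C) _.
  by have:= first_isog_loc (conj_aut P) nPC; rewrite /= ker_conj_aut cCP.
exists C; split=> //.
  by rewrite astabsJ /faithful astabJ cCP.
split.
- rewrite (isog_cyclic isoC); apply: cyclicS (Aut_conj_aut P C) _.
  by rewrite Aut_prime_cyclic ?oP.
- rewrite (card_isog isoC) -(totient_prime p_pr) -oP.
  rewrite -card_Aut_cyclic ?prime_cyclic ?oP //.
  exact: cardSg (Aut_conj_aut P C).
by apply: contra_neq => C1; rewrite -defG C1 mulg1.
Qed.

End SelfCentralizing.

(** * Groups whose abelian subgroups have order below 2p *)

Section SmallAbelian.

Variables (gT : finGroupType) (G P : {group gT}) (p : nat).
Hypothesis small_abelian :
  forall A : {group gT}, A \subset G -> abelian A -> #|A| < 2 * p.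

(** The index of [B] in [A] is less than 2. *)
Lemma small_abelian_card (A B : {group gT}) :
  A \subset G -> abelian A -> B \subset A -> p <= #|B| -> A :=: B.
Proof.
move=> sAG abA sBA leB; apply/esym/eqP; rewrite eqEcard sBA /= leqNgt.
apply/negP=> ltBA; have := small_abelian sAG abA; rewrite ltnNge => /negP[].
have /dvdnP[k oA] := cardSg sBA; rewrite oA leq_mul //.
by case: k oA ltBA => [|[|k]] ->; rewrite ?mul0n ?mul1n ?ltnn.
Qed.

(** An element [y] centralizing [B] generates with [B] an abelian group, which is
    then no larger than [B]. *)
Lemma small_abelian_self_cent (B : {group gT}) :
  B \subset G -> abelian B -> p <= #|B| -> 'C_G(B) = B.
Proof.
move=> sBG abB leB; apply/eqP; rewrite eqEsubset subsetI sBG [B \subset _]abB.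
rewrite !andbT; apply/subsetP=> y /setIP[Gy cBy].
have abBy : abelian (B <*> <[y]>).
  by rewrite abelianY abB cycle_abelian cycle_subG.
have sBy : B <*> <[y]> \subset G by rewrite join_subG sBG cycle_subG.
rewrite -(small_abelian_card sBy abBy (joing_subl _ _) leB).
by rewrite (subsetP (joing_subr _ _)) ?cycle_id.
Qed.

Hypotheses (p_pr : prime p) (sPG : P \subset G) (oP : #|P| = p).

Lemma small_abelian_prime_self_cent : 'C_G(P) = P.
Proof.
apply: small_abelian_self_cent => //; last by rewrite oP.
by rewrite cyclic_abelian // prime_cyclic // oP.
Qed.

Let cGP := small_abelian_prime_self_cent.

(** The order of [A] is 1 modulo [p], greater than 1 and less than [2p]. *)
Lemma small_abelian_p'card (A : {group gT}) :
    A \subset G -> abelian A -> P \subset 'N(A) -> A :!=: 1 -> ~~ (p %| #|A|) ->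
  #|A| = p.+1.
Proof.
move=> sAG abA nAP ntA pA.
have := self_cent_p'card_mod p_pr oP cGP sAG nAP pA.
move/eqP; rewrite eqn_mod_dvd ?cardG_gt0 //.
have := small_abelian sAG abA; move: ntA; rewrite -cardG_gt1.
move: #|A| => [|[|n]] //= _ lt2p; rewrite subSS subn0 => /dvdnP[[|[|k]]] //.
  by rewrite mul1n => ->.
move=> defn; rewrite defn in lt2p; case/negP: (negbT (ltnn (2 * p))).
by apply: leq_ltn_trans lt2p; rewrite ltnW // ltnS leq_mul.
Qed.

(** The centre of a [P]-invariant Sylow [r]-subgroup of [N] has order [p + 1], so
    [p + 1] is a power of [r]; it equals 3 if [p = 2] and is even otherwise. *)
Lemma normal_p'group_prime_divisors (N : {group gT}) r :
    N <| G -> ~~ (p %| #|N|) -> prime r -> r %| #|N| ->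
  r = (if p == 2 then 3 else 2).
Proof.
move=> /andP[sNG nNG] pN r_pr rN.
have solP : solvable P.
  by rewrite abelian_sol // cyclic_abelian // prime_cyclic // oP.
have coNP : coprime #|N| #|P| by rewrite oP coprime_sym prime_coprime.
have [R sylR nRP] :=
  sol_coprime_Sylow_exists r solP (subset_trans sPG nNG) coNP.
have rR := pHall_pgroup sylR; have sRN := pHall_sub sylR.
have rZ : r.-group 'Z(R) := pgroupS (center_sub R) rR.
have ntR : R :!=: 1.
  by rewrite -cardG_gt1 (card_Hall sylR) p_part_gt1 mem_primes r_pr cardG_gt0.
have ntZ : 'Z(R) != 1 by rewrite (center_nil_eq1 (pgroup_nil rR)).
have sZN : 'Z(R) \subset N := subset_trans (center_sub R) sRN.
have oZ : #|'Z(R)| = p.+1.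
  apply: small_abelian_p'card (center_abelian R) _ ntZ _ => //.
  - exact: subset_trans sZN sNG.
  - exact: char_norm_trans (center_char R) nRP.
  by apply: contra pN => pZ; apply: dvdn_trans (cardSg sZN).
have qr q : prime q -> q %| p.+1 -> r = q.
  move=> q_pr qp; move: rZ; rewrite /pgroup oZ.
  by case/(pnatP _ (ltn0Sn p))/(_ q q_pr qp)/eqnP.
case: eqP => [p2 | /eqP p2]; first by apply: qr; rewrite ?p2.
by apply: qr; rewrite // dvdn2 /= negbK; case: (even_prime p_pr) p2 => [->|->].
Qed.

End SmallAbelian.

(** * Large prime divisors of the group order *)

Theorem theorem2p3 (gT : finGroupType) (G : {group gT}) (m p : nat)
    (hm : m = (\max_(A : {group gT} | (A \subset G) && abelian A) #|A|)%N)
    (hp : prime p) (hpG : (p %| #|G|)%N) (hpm : (m < 2 * p)%N) :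
  [\/ exists P C : {group gT},
        [/\ [/\ P \subset G, C \subset G & G = P * C :> {set gT}],
            #|P| = p,
            [acts C, on P | 'J] /\ [faithful C, on P | 'J]
          & [/\ cyclic C, (#|C| %| p.-1)%N & (#|G| != p -> C :!=: 1)]],
      G \isog [set: 'S_3] /\ (p = 2 \/ p = 3),
      exists (a : nat) (F : finFieldType),
        [/\ p = (2 ^ a - 1)%N, #|F| = (2 ^ a)%N
          & exists2 K : {group gT}, K \subset G & K \isog 'F(AGammaL1 F)]
    | almost_simple G].
Proof.
have smallG (A : {group gT}) : A \subset G -> abelian A -> #|A| < 2 * p.
  move=> sAG abA; apply: leq_ltn_trans hpm; rewrite hm.
  by apply: (leq_bigmax_cond (F := fun B : {group gT} => #|B|)); rewrite sAG.
have ntG : G :!=: 1.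
  by rewrite -cardG_gt1 (leq_trans (prime_gt1 hp)) // dvdn_leq.
have [N minN sNG] := minnormal_exists ntG (normG G).
have [ntN nNG] := andP (mingroupp minN).
have nsNG : N <| G by apply/andP.
have [pN | pN] := boolP (p %| #|N|).
  (* Taking [x] in [N] places the centralizer of [N], which centralizes [x],
     inside [<[x]>] and so inside [N]. *)
  have [x Nx ox] := Cauchy hp pN.
  have sxN : <[x]> \subset N by rewrite cycle_subG.
  have sxG := subset_trans sxN sNG.
  have oP : #|<[x]>| = p by [].
  have cPP := small_abelian_prime_self_cent smallG hp sxG oP.
  have sylP := self_cent_Sylow hp oP cPP.
  have p2N : ~~ (p ^ 2 %| #|N|).
    apply/negP=> /dvdn_trans/(_ (cardSg sNG)).
    rewrite pfactor_dvdn // -(leq_exp2l _ _ (prime_gt1 hp)) -p_part.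
    by rewrite -(card_Hall sylP) /= oP leqNgt -{1}(expn1 p) ltn_exp2l ?prime_gt1.
  have simN := charsimple_simple (minnormal_charsimple minN) hp pN p2N.
  have [abN | nabN] := boolP (abelian N).
    have oN : #|N| = p.
      have pr_N := simple_sol_prime (abelian_sol abN) simN.
      by apply/esym/eqP; rewrite -dvdn_prime2.
    have cNN := small_abelian_prime_self_cent smallG hp sNG oN.
    have [C [? ? ? ?]] := self_cent_normal_complement hp oN cNN nsNG.
    by constructor 1; exists N, C.
  constructor 4; apply: (almost_simple_cent1 simN nabN nsNG).
  have sCN : 'C_G(N) \subset N.
    apply: subset_trans (subset_trans (setIS G (centS sxN)) _) sxN.
    by rewrite cPP.
  have [_ /(_ _ (center_normal N)) simZ] := simpleP _ simN.
  case: simZ => [Z1 | ZN].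
    by apply/trivgP; rewrite -Z1 subsetI sCN subsetIr.
  by case/negP: nabN; rewrite -ZN center_abelian.
have [x Gx ox] := Cauchy hp hpG.
have sPG : <[x]> \subset G by rewrite cycle_subG.
have oP : #|<[x]>| = p by [].
have divN r := normal_p'group_prime_divisors smallG hp sPG oP nsNG pN (r := r).
pose q := if p == 2 then 3 else 2.
have q_pr : prime q by rewrite /q; case: ifP.
have qN : q.-group N.
  by apply/pnatP=> // r r_pr rN; rewrite inE; apply/eqP/divN.
have solN : solvable N := nilpotent_sol (pgroup_nil qN).
have /is_abelemP[r r_pr abelN] :=
  charsimple_solvable (minnormal_charsimple minN) solN.
have abN := abelem_abelian abelN.
have oN : #|N| = p.+1.
  apply: (small_abelian_p'card smallG hp sPG oP) => //.
  exact: subset_trans sPG nNG.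
have defr : r = q.
  by have [_ rN _] := pgroup_pdiv (abelem_pgroup abelN) ntN; apply: divN.
move: abelN; rewrite {}defr /q; have [p2 | _] := eqVneq p 2 => abelN.
  constructor 2; split; last by left.
  have leN : p <= #|N| by rewrite oN.
  have cNN := small_abelian_self_cent smallG sNG abN leN.
  (* As [N] is self-centralizing of order 3, [G / N] embeds in [Aut N], which has
     order 2, while [#|G|] is even. *)
  have oG : #|G| = 6.
    have isoGN := first_isog_loc (conj_aut N) nNG.
    rewrite /= ker_conj_aut cNN in isoGN.
    have oGN : #|G : N| %| 2.
      rewrite -card_quotient // (card_isog isoGN).
      apply: dvdn_trans (cardSg (Aut_conj_aut N G)) _.
      by rewrite card_Aut_cyclic ?prime_cyclic ?oN ?p2.
    have := hpG; rewrite -(Lagrange sNG) oN p2.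
    by move: oGN; rewrite dvdn_divisors // !inE => /orP[] /eqP->.
  have cPP : 'C_G(<[x]>) = <[x]>.
    exact: small_abelian_prime_self_cent smallG hp sPG oP.
  (* A conjugate of [x] by an element not commuting with it is a second
     involution. *)
  have /subsetPn[y Gy cxy] : ~~ (G \subset 'C[x]).
    rewrite -cent_cycle; apply/negP=> /setIidPl; rewrite cPP => eqG.
    by move: oG; rewrite -eqG oP p2.
  apply: (order6_Sym3 oG Gx (groupJ Gx Gy)); rewrite ?orderJ ?ox //.
  apply: contra cxy => /eqP xy; rewrite cent1C.
  exact/cent1P/commgP/conjg_fixP/esym.
constructor 3.
have [a oNa] : exists a, #|N| = (2 ^ a)%N.
  by have [a] := p_natP (abelem_pgroup abelN); exists a.
have a_gt0 : 0 < a.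
  by case: a oNa => //; rewrite oN => -[p0]; rewrite p0 in hp.
have [F charF oF] := pPrimePowerField (isT : prime 2) a_gt0.
exists a, F; split=> //; first by rewrite -oNa oN subn1.
exists N => //; rewrite Fitting_AGammaL1 (isog_abelem_card _ abelN).
by rewrite translations_abelem //= card_translations oF oNa.
Qed.
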